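(* For any connected graph $G$ of order $n(G)$ with maximum degree $\Delta(G)$, $$\max\{n(G),\ 2\mu_i(G),\ 2\Delta(G)\} \le \mu(S(G)) \le \min\{n(G)+\mu(G),\ 2n(G)-2\}.$$
   Context: All graphs are simple. The shadow graph $S(G)$ of a graph $G$ is obtained from $G$ by adding, for each vertex $v$ of $G$, a new vertex $v'$ (the shadow vertex of $v$), and joining $v'$ to all neighbours of $v$ in $G$ (shadow vertices are pairwise non-adjacent). For a vertex set $X$ of a graph $H$, two vertices $u,v$ are $X$-visible if there is a shortest $u,v$-path $P$ in $H$ with $V(P)\cap X \subseteq \{u,v\}$. The set $X$ is a mutual-visibility set if every two vertices of $X$ are $X$-visible; $\mu(H)$ is the maximum cardinality of a mutual-visibility set of $H$, and $\mu_i(H)$ is the maximum cardinality of a mutual-visibility set of $H$ that is an independent set.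
   Formalization: The graph G is assumed to have order n(G) at least 2; for the one-vertex graph the stated chain fails, since the left side is at least 1 while 2n(G)-2 = 0. *)

(* Defs.v *)
From mathcomp Require Import all_boot.
From mathcomp Require Import boolp.

Set Implicit Arguments.
Unset Strict Implicit.
Unset Printing Implicit Defensive.

Record sgraph := SGraph {
  vertex :> finType;
  adj : rel vertex;
  adj_sym : symmetric adj;
  adj_irrefl : irreflexive adj }.

Definition connected (G : sgraph) : Prop :=
  0 < #|G| /\ forall u v : G, connect (@adj G) u v.

Definition nbh (G : sgraph) (v : G) : {set G} := [set u | adj v u].

Definition max_degree (G : sgraph) : nat := \max_(v : G) #|nbh v|.

Definition independent (G : sgraph) (X : {set G}) : Prop :=
  forall u v : G, u \in X -> v \in X -> ~~ adj u v.

Section Shadow.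
Variable G : sgraph.

(* inl v is the original vertex v, inr v its shadow v'. *)
Definition shadow_adj (x y : G + G) : bool :=
  match x, y with
  | inl u, inl v | inl u, inr v | inr u, inl v => adj u v
  | inr _, inr _ => false
  end.

Lemma shadow_adj_sym : symmetric shadow_adj.
Proof. by move=> [u|u] [v|v] //=; rewrite adj_sym. Qed.

Lemma shadow_adj_irrefl : irreflexive shadow_adj.
Proof. by move=> [u|u] //=; rewrite adj_irrefl. Qed.

Definition shadow : sgraph := SGraph shadow_adj_sym shadow_adj_irrefl.

End Shadow.

Section MutualVisibility.
Variable H : sgraph.

(* u :: p is the vertex sequence of the path; its length is size p. *)
Definition uv_path (u v : H) (p : seq H) : Prop :=
  [/\ path (@adj H) u p, last u p = v & uniq (u :: p)].

Definition shortest_path (u v : H) (p : seq H) : Prop :=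
  uv_path u v p /\ forall q, uv_path u v q -> size p <= size q.

Definition visible (X : {set H}) (u v : H) : Prop :=
  exists2 p, shortest_path u v p & [set x in u :: p] :&: X \subset [set u; v].

Definition mutual_visibility (X : {set H}) : Prop :=
  forall u v : H, u \in X -> v \in X -> u != v -> visible X u v.

Definition mu : nat :=
  \max_(X : {set H} | `[< mutual_visibility X >]) #|X|.

Definition mu_i : nat :=
  \max_(X : {set H} | `[< mutual_visibility X /\ independent X >]) #|X|.

End MutualVisibility.

(* Main.v *)
Require Import Defs.
From mathcomp Require Import all_boot.
From mathcomp Require Import boolp zify.

Set Implicit Arguments.
Unset Strict Implicit.
Unset Printing Implicit Defensive.

(** Walks of S(G) project to walks of G of the same length, and a walk of G
    whose interior is nonempty lifts to a walk of S(G) with prescribed lifts of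
    its ends and with interior in the copy of G.  Hence geodesics transfer, and
    the following sets are mutual-visibility sets of S(G): all the shadows; the
    preimage of an independent mutual-visibility set of G; the preimage of a
    neighbourhood N(v), through v.

    For the upper bounds, let X be a mutual-visibility set of S(G).  The
    vertices v with both v and v' in X form a mutual-visibility set of G, and
    |X| exceeds their number by at most n.  If at most one vertex z of S(G)
    were outside X, every two distinct non-adjacent vertices of X would be
    adjacent to z; a pair u, u' in X forces z = w with w adjacent to u, and
    then the pair u', w' would force w' to be adjacent to w. *)

Section Visibility.
Variable H : sgraph.
Implicit Types (X Y : {set H}) (u v : H) (p q : seq H).

(* Here [p] lists the interior vertices of a u,v-walk. *)
Definition geodesic u v p : Prop :=
  path (@adj H) u (rcons p v) /\
  forall q, path (@adj H) u (rcons q v) -> size p <= size q.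

Lemma walk_shorten u v q : path (@adj H) u (rcons q v) ->
  exists r, [/\ uv_path u v r, size r <= (size q).+1 &
                {subset r <= rcons q v}].
Proof.
move=> pq; have lq : last u (rcons q v) = v by rewrite last_rcons.
case: (shortenP pq) lq => r rp ur sr lr.
exists r; split=> //.
by rewrite -(size_rcons q v) uniq_leq_size //; case/andP: ur.
Qed.

(** A shortest walk repeats no vertex, so minimality among walks and among paths agree. As [u != v],
    the path has a last step, and meeting [X] only at the ends means that its interior avoids
    [X]. *)
Lemma visibleP X u v : u != v ->
  visible X u v <-> exists2 p, geodesic u v p & {in p, forall x, x \notin X}.
Proof.
move=> uv; split=> [[p [[pp lp up] minp] sub]|[p [pp minp] pX]].
- case/lastP: p => [|p w] in pp lp up minp sub *.
    by move: uv; rewrite -lp eqxx.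
  rewrite last_rcons in lp; subst w; exists p.
    split=> // q /walk_shorten[r [/minp + le _]].
    by rewrite size_rcons => /leq_trans/(_ le).
  move=> x xp; apply/negP => xX.
  have /(subsetP sub) : x \in [set x in u :: rcons p v] :&: X.
    by rewrite !inE mem_rcons !inE xp xX !orbT.
  rewrite !inE => /orP[] /eqP xE; subst x; move: up => /=.
    by rewrite mem_rcons inE xp orbT.
  by rewrite rcons_uniq xp andbF.
- have [r [rp sr subr]] := walk_shorten pp.
  exists r.
    split=> // q [qp lq _].
    case/lastP: q => [|q w] in qp lq *; first by move: uv; rewrite -lq eqxx.
    rewrite last_rcons in lq; subst w.
    by rewrite size_rcons (leq_trans sr) // ltnS minp.
  apply/subsetP => x; rewrite !inE => /andP[/orP[-> //|/subr + xX]].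
  by rewrite mem_rcons inE => /orP[->|/pX]; rewrite ?orbT // xX.
Qed.

Lemma geodesic_exists u v : u != v -> connect (@adj H) u v ->
  exists p, geodesic u v p.
Proof.
move=> uv /connectP[p pp vE].
have exP : exists n, `[< exists q, path (@adj H) u (rcons q v) /\ size q = n >].
  case/lastP: p => [|p w] in pp vE *; first by rewrite vE eqxx in uv.
  by rewrite last_rcons in vE; subst w; exists (size p); apply/asboolP; exists p.
case: (ex_minnP exP) => _ /asboolP[q [qp <-]] minq.
by exists q; split=> // r rp; apply: minq; apply/asboolP; exists r.
Qed.

Lemma geodesic_edge u v : adj u v -> geodesic u v [::].
Proof. by move=> uv; split; rewrite //= uv. Qed.

Lemma geodesic_dist2 u v w : ~~ adj u v -> adj u w -> adj w v ->
  geodesic u v [:: w].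
Proof. by move=> nuv uw wv; split=> [|[|//]]; rewrite /= ?uw ?wv ?(negPf nuv). Qed.

Lemma visible_neighbour X u v : u != v -> ~~ adj u v -> visible X u v ->
  exists2 z, z \notin X & adj u z.
Proof.
move=> uv nuv /(visibleP _ uv)[[|z p] [/= pp _] pX].
  by rewrite andbT (negPf nuv) in pp.
by exists z; [rewrite pX ?mem_head | case/andP: pp].
Qed.

Lemma leq_mu X : mutual_visibility X -> #|X| <= mu H.
Proof. by move=> /asboolP; apply: (@leq_bigmax_cond _ _ (fun X : {set H} => #|X|)). Qed.

Lemma mutual_visibility_common_neighbour Y w : {in Y, forall x, adj x w} ->
  w \notin Y -> mutual_visibility Y.
Proof.
move=> Yw wY u v uY vY uv; apply/(visibleP _ uv).
case: (boolP (adj u v)) => [/geodesic_edge|nuv]; first by exists [::].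
exists [:: w]; first by apply: geodesic_dist2; rewrite 1?[adj w v]adj_sym ?Yw.
by move=> x; rewrite inE => /eqP->.
Qed.

End Visibility.

Lemma neighbour_exists (G : sgraph) (u : G) :
  connected G -> 2 <= #|G| -> exists w, adj u w.
Proof.
move=> [_ conn] hn.
have /card_gt0P[v] : 0 < #|[set~ u]| by rewrite cardsC1; lia.
rewrite !inE => vu; case/connectP: (conn u v) => [[|w p]] /=.
  by move=> _ vE; rewrite vE eqxx in vu.
by case/andP=> uw _ _; exists w.
Qed.

Section ShadowVisibility.
Variable G : sgraph.
Implicit Types (x y : shadow G) (u v w : G).

Definition proj x : G := match x with inl u | inr u => u end.

Definition orig u : shadow G := inl u.
Definition shad u : shadow G := inr u.

Lemma orig_inj : injective orig. Proof. by move=> u v []. Qed.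
Lemma shad_inj : injective shad. Proof. by move=> u v []. Qed.

Lemma path_proj x (p : seq (shadow G)) :
  path (@adj (shadow G)) x p -> path (@adj G) (proj x) (map proj p).
Proof. by apply: homo_path => - [a|a] [b|b]. Qed.

Lemma path_orig u (p : seq G) :
  path (@adj G) u p -> path (@adj (shadow G)) (orig u) (map orig p).
Proof. by apply: homo_path. Qed.

(** The interior must be nonempty: shadows of adjacent vertices are not adjacent. *)
Lemma path_lift x y (p : seq G) : p != [::] ->
  path (@adj G) (proj x) (rcons p (proj y)) ->
  path (@adj (shadow G)) x (rcons (map orig p) y).
Proof.
case: p => [//|w p] _ /=; rewrite !rcons_path => /and3P[xw pp py].
apply/and3P; split; first by case: x xw.
  exact: path_orig.
by rewrite last_map; case: y py.
Qed.

Lemma geodesic_lift x y (p : seq G) : p != [::] ->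
  geodesic (proj x) (proj y) p -> geodesic x y (map orig p).
Proof.
move=> p0 [pp minp]; split=> [|q /path_proj]; first exact: path_lift.
by rewrite map_rcons => /minp; rewrite !size_map.
Qed.

Lemma geodesic_proj u v (p : seq (shadow G)) :
  geodesic (orig u) (orig v) p -> geodesic u v (map proj p).
Proof.
move=> [pp minp]; split=> [|q /path_orig].
  by have := path_proj pp; rewrite map_rcons.
by rewrite map_rcons => /minp; rewrite !size_map.
Qed.

Lemma connect_orig u v : connect (@adj G) u v ->
  connect (@adj (shadow G)) (orig u) (orig v).
Proof.
case/connectP=> p pp ->; apply/connectP; exists (map orig p).
  exact: path_orig.
by rewrite last_map.
Qed.

Lemma card_shadow_set (X : {set shadow G}) :
  #|X| = #|orig @^-1: X| + #|shad @^-1: X|.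
Proof.
rewrite -(card_imset _ orig_inj) -(card_imset _ shad_inj).
rewrite -cardsUI [X in _ + X]eq_card0 ?addn0.
  apply: eq_card => x; rewrite !inE.
  apply/idP/orP => [xX|[] /imsetP[u + ->]]; last 2 first.
  - by rewrite inE.
  - by rewrite inE.
  case: x xX => u uX; [left | right].
    by apply/imsetP; exists u; rewrite ?inE.
  by apply/imsetP; exists u; rewrite ?inE.
move=> x; rewrite !inE; apply/negP => /andP[/imsetP[u _ ->] /imsetP[v _]].
by [].
Qed.

Lemma card_proj_preim (Y : {set G}) : #|proj @^-1: Y| = 2 * #|Y|.
Proof.
rewrite card_shadow_set mul2n -addnn.
by congr (_ + _); apply: eq_card => u; rewrite !inE.
Qed.

Lemma card_shadow : #|shadow G| = 2 * #|G|.
Proof. by rewrite card_sum mul2n addnn. Qed.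

Lemma mutual_visibility_shadows : connected G -> 2 <= #|G| ->
  mutual_visibility [set shad u | u in G].
Proof.
move=> Gc hn _ _ /imsetP[u _ ->] /imsetP[v _ ->] uv; apply/(visibleP _ uv).
have [a ua] := neighbour_exists u Gc hn; have [b vb] := neighbour_exists v Gc hn.
have : connect (@adj (shadow G)) (shad u) (shad v).
  apply: (connect_trans (y := orig a)); first exact: connect1.
  apply: (connect_trans (y := orig b)); first by apply: connect_orig; case: Gc.
  by apply: connect1; rewrite /= adj_sym.
case/(geodesic_exists uv) => p [pp minp].
(* Projecting and lifting back keeps the length and moves the interior off the shadows. The interior
   is nonempty because two shadows are never adjacent. *)
exists (map orig (map proj p)).
  split=> [|q /minp]; last by rewrite !size_map.
  apply: path_lift; first by case: p pp {minp}.
  by have := path_proj pp; rewrite map_rcons.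
by move=> _ /mapP[w _ ->]; apply/imsetP => - [].
Qed.

(** Independence serves twice: two lifts of one vertex see each other through a neighbour outside
    [Y], and geodesics between distinct vertices of [Y] have an interior, hence lift. *)
Lemma mutual_visibility_proj_preim (Y : {set G}) :
  connected G -> 2 <= #|G| -> mutual_visibility Y -> independent Y ->
  mutual_visibility (proj @^-1: Y).
Proof.
move=> Gc hn mY iY x y; rewrite !inE => xY yY xy; apply/(visibleP _ xy).
have [pxy|pxy] := eqVneq (proj x) (proj y).
  have [w xw] := neighbour_exists (proj x) Gc hn.
  exists [:: orig w].
    apply: geodesic_dist2.
    - by case: x y pxy {xy xY yY xw} => [u|u] [v|v] //= ->; rewrite adj_irrefl.
    - by case: x xw {xy xY pxy}.
    - by rewrite adj_sym; rewrite pxy in xw; case: y xw {xy yY pxy}.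
  move=> z; rewrite !inE => /eqP-> /=.
  by apply/negP => wY; move: (iY _ _ xY wY); rewrite xw.
have /(visibleP _ pxy)[p gp pY] := mY _ _ xY yY pxy.
exists (map orig p).
  apply: geodesic_lift => //; apply/eqP => p0; move: gp.1.
  by rewrite p0 /= andbT; apply/negP; apply: iY.
by move=> _ /mapP[w wp ->]; rewrite inE pY.
Qed.

Lemma mutual_visibility_nbh_preim w : mutual_visibility (proj @^-1: nbh w).
Proof.
apply: (@mutual_visibility_common_neighbour _ _ (orig w)) => [x|].
  by rewrite !inE adj_sym; case: x.
by rewrite !inE /= adj_irrefl.
Qed.

Lemma mutual_visibility_double (X : {set shadow G}) : mutual_visibility X ->
  mutual_visibility (orig @^-1: X :&: shad @^-1: X).
Proof.
move=> mX u v; rewrite !inE => /andP[uX _] /andP[vX _] uv.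
have ouv : orig u != orig v by rewrite (inj_eq orig_inj).
apply/(visibleP _ uv); have /(visibleP _ ouv)[p gp pX] := mX _ _ uX vX ouv.
exists (map proj p); first exact: geodesic_proj.
(* One lift of [proj z], namely [z], is outside [X]. *)
move=> _ /mapP[z /pX zX ->]; rewrite !inE negb_and.
by case: z zX => w wX; apply/orP; [left | right].
Qed.

Lemma mutual_visibility_two_missed (X : {set shadow G}) : 2 <= #|G| -> mutual_visibility X ->
  2 <= #|~: X|.
Proof.
move=> hn mX; rewrite leqNgt ltnS; apply/negP => /card_le1_eqP X1.
have missed1 (y z : shadow G) : y \notin X -> z \notin X -> y = z.
  by move=> yX zX; apply: X1; rewrite inE.
(* Otherwise two distinct vertices of [G] would each have a lift outside [X]. *)
have [u [ouX suX]] : exists u, orig u \in X /\ shad u \in X.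
  have /card_gt1P[a [b [_ _ ab]]] := hn.
  have [aX|] := boolP ((orig a \in X) && (shad a \in X)).
    by exists a; apply/andP.
  have [bX|] := boolP ((orig b \in X) && (shad b \in X)).
    by exists b; apply/andP.
  rewrite !negb_and => hb ha; case/eqP: ab.
  by case/orP: ha => ha; case/orP: hb => hb; have /(congr1 proj) := missed1 _ _ ha hb.
(* A shadow has only original vertices as neighbours, so the missed vertex is some [orig w]. *)
have [[w|//] wX uw] := visible_neighbour (isT : shad u != orig u)
  (negbT (adj_irrefl u)) (mX _ _ suX ouX isT).
have swX : shad w \in X.
  by apply: contraT => swX; have := missed1 _ _ swX wX.
have swu : shad w != shad u.
  by apply/eqP => - [wu]; move: uw; rewrite wu /= adj_irrefl.
have [z zX wz] := visible_neighbour swu isT (mX _ _ swX suX swu).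
by move: wz; rewrite (missed1 _ _ zX wX) /= adj_irrefl.
Qed.

End ShadowVisibility.

Theorem theorem4p1 (G : sgraph) (hconn : connected G) (hn : 2 <= #|G|) :
  maxn #|G| (maxn (2 * mu_i G) (2 * max_degree G)) <= mu (shadow G)
    <= minn (#|G| + mu G) (2 * #|G| - 2).
Proof.
rewrite !geq_max leq_min; apply/andP; split.
- apply/and3P; split.
  + have := leq_mu (mutual_visibility_shadows hconn hn).
    by rewrite (card_imset _ (@shad_inj G)).
  (* The empty set qualifies, so the maximum is attained. *)
  + have : 0 < #|[pred X : {set G} |
        `[< mutual_visibility X /\ independent X >]]|.
      apply/card_gt0P; exists set0; rewrite inE; apply/asboolP.
      by split=> u v; rewrite inE.
    case/(eq_bigmax_cond (fun X : {set G} => #|X|)) => X /asboolP[mX iX].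
    rewrite /mu_i => ->; rewrite -card_proj_preim.
    exact/leq_mu/mutual_visibility_proj_preim.
  + rewrite /max_degree; have [w ->] := eq_bigmax (fun v : G => #|nbh v|) hconn.1.
    by rewrite -card_proj_preim; apply/leq_mu/mutual_visibility_nbh_preim.
- apply/andP; split; apply/bigmax_leqP => X /asboolP mX.
  (* The two preimages have a union of size at most [#|G|], and their intersection is a
     mutual-visibility set of [G]. *)
  + rewrite card_shadow_set -cardsUI leq_add ?max_card //.
    exact/leq_mu/mutual_visibility_double.
  + have := mutual_visibility_two_missed hn mX; have := cardsC X; rewrite card_shadow; lia.
Qed.
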